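(* Let $G$ be a locally compact Abelian group which is also a topological vector space over $\mathbb{R}$. Let $\Omega_{+}$ and $\Omega_{-}$ be bounded $0$-symmetric sets in $G$ such that $r\overline{\Omega_{+}}\subset\operatorname{int}\Omega_{+}$ and $r\overline{\Omega_{-}}\subset\operatorname{int}\Omega_{-}$ for all $r\in[0,1)$. Then $$\mathcal{C}^{*}_{G}(\operatorname{int}\Omega_{+},\operatorname{int}\Omega_{-})=\mathcal{C}^{*}_{G}(\Omega_{+},\Omega_{-})=\mathcal{C}_{G}(\Omega_{+},\Omega_{-})=\mathcal{C}_{G}(\operatorname{int}\Omega_{+},\operatorname{int}\Omega_{-})=\mathcal{C}_{G}(\overline{\operatorname{int}\Omega_{+}},\overline{\operatorname{int}\Omega_{-}})=\mathcal{C}^{*}_{G}(\overline{\operatorname{int}\Omega_{+}},\overline{\operatorname{int}\Omega_{-}})=\mathcal{C}^{*}_{G}(\overline{\Omega_{+}},\overline{\Omega_{-}}).$$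
   Context: All locally compact Abelian (LCA) groups are Hausdorff, written additively with identity $0$, and $\lambda_G$ denotes a fixed Haar measure on $G$. The topological vector space structure has the same addition and topology as the group. A set $\Omega\subset G$ is $0$-symmetric if $\Omega=-\Omega$. $\operatorname{int}$ denotes interior. Here $A \subset B$ does not mean strict inclusion. A function $f:G\to\mathbb{R}$ is positive definite if $\sum_{i=1}^{n}\sum_{j=1}^{n}c_i\overline{c_j}f(g_i-g_j)\ge 0$ for all $n\in\mathbb{N}$, $c_i\in\mathbb{C}$, $g_i\in G$. $P_1(G)$ is the set of continuous positive definite functions $f:G\to\mathbb{R}$ with $f(0)=1$. Write $f_+:=\max\{f,0\}$, $f_-:=\max\{-f,0\}$, and $\operatorname{supp} f:=\overline{\{g\in G: f(g)\neq 0\}}$. For subsets $\Omega_+,\Omega_-\subset G$, $$\mathcal{F}_{G}(\Omega_{+},\Omega_{-}):=\{f\in P_1(G)\cap L^1(G): f^{-1}((0,\infty))\subset\Omega_{+},\ f^{-1}((-\infty,0))\subset\Omega_{-}\},$$ $$\mathcal{F}^{*}_{G}(\Omega_{+},\Omega_{-}):=\{f\in P_1(G)\cap L^1(G): \operatorname{supp} f_+\subset\Omega_{+},\ \operatorname{supp} f_-\subset\Omega_{-}\},$$ and $\mathcal{C}_{G}(\Omega_{+},\Omega_{-})$, respectively $\mathcal{C}^{*}_{G}(\Omega_{+},\Omega_{-})$, is the supremum of $\int_G f\,d\lambda_G$ over $f\in\mathcal{F}_{G}(\Omega_{+},\Omega_{-})$, respectively $f\in\mathcal{F}^{*}_{G}(\Omega_{+},\Omega_{-})$,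 with the convention that the value is $0$ if the class is empty. *)

(* Defs.v *)
From HB Require Import structures.
From mathcomp Require Import all_boot all_order all_algebra.
From mathcomp Require Import all_classical all_reals all_analysis.
From mathcomp Require Import complex.

Set Implicit Arguments.
Unset Strict Implicit.
Unset Printing Implicit Defensive.

Import Order.TTheory GRing.Theory Num.Theory.
Import numFieldNormedType.Exports.

Local Open Scope classical_set_scope.
Local Open Scope ring_scope.

(* The group G with its Borel sigma-algebra. [g_sigma_algebraType] asks for a
   pointed carrier; the library points a [zmodType] at 0, but does not see a
   [topologicalZmodType] as pointed without the cast. *)
Definition borel (G : topologicalZmodType) :=
  g_sigma_algebraType (@open G : set (set (G : zmodType))).

(* Haar measures are the nonzero translation-invariant Radon measures. *)
Record is_haar (R : realType) (G : topologicalZmodType)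
    (mu : {measure set (borel G) -> \bar R}) : Prop := {
  haar_neq0 : mu [set: G] != 0%E ;
  haar_translation : forall (x : G) (A : set (borel G)), measurable A ->
    mu [set x + a | a in (A : set G)] = mu A ;
  haar_compact : forall K : set G, compact K -> (mu K < +oo)%E ;
  haar_outer_regular : forall A : set (borel G), measurable A ->
    mu A = ereal_inf [set mu U | U in [set U : set G | open U /\ A `<=` U]] ;
  haar_inner_regular : forall U : set G, open U ->
    mu U = ereal_sup [set mu K | K in [set K : set G | compact K /\ K `<=` U]]
}.

(* In R[i], [0 <= z] says that z is real and nonnegative. *)
Definition positive_definite (R : realType) (G : zmodType) (f : G -> R) :
    Prop :=
  forall (n : nat) (c : 'I_n -> R[i]) (g : 'I_n -> G),
    0 <= \sum_(i < n) \sum_(j < n)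
           c i * ((c j)^*)%C * ((f (g i - g j))%:C)%C.

Definition P1 (R : realType) (G : topologicalZmodType) : set (G -> R) :=
  [set f | [/\ continuous f, positive_definite f & f 0 = 1]].

Definition L1 (R : realType) (G : topologicalZmodType)
    (mu : {measure set (borel G) -> \bar R}) : set (G -> R) :=
  [set f | mu.-integrable [set: borel G] (fun x => (f x)%:E)].

Definition supp (R : realType) (G : topologicalType) (f : G -> R) : set G :=
  closure [set g | f g != 0].

Section Delsarte.
Context (R : realType) (G : topologicalZmodType).
Context (mu : {measure set (borel G) -> \bar R}).
Implicit Types Omegap Omegam : set G.

Definition delsarte_class Omegap Omegam : set (G -> R) :=
  [set f | [/\ P1 f, L1 mu f, f @^-1` `]0, +oo[ `<=` Omegap
             & f @^-1` `]-oo, 0[ `<=` Omegam]].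

Definition delsarte_class_supp Omegap Omegam : set (G -> R) :=
  [set f | [/\ P1 f, L1 mu f, supp f^\+ `<=` Omegap & supp f^\- `<=` Omegam]].

Definition sup_integral (F : set (G -> R)) : \bar R :=
  if `[< F !=set0 >]
  then ereal_sup [set (\int[mu]_x (f x)%:E)%E | f in F]
  else 0%E.

Definition delsarte_const Omegap Omegam :=
  sup_integral (delsarte_class Omegap Omegam).

Definition delsarte_const_supp Omegap Omegam :=
  sup_integral (delsarte_class_supp Omegap Omegam).

End Delsarte.

Definition zero_symmetric (G : zmodType) (A : set G) : Prop := A = -%R @` A.

(* Boundedness in a topological vector space: every neighbourhood of 0 absorbs
   the set. The library's [bounded_set] needs a norm. *)
Definition tvs_bounded (R : realType) (G : topologicalLmodType R)
    (A : set G) : Prop :=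
  forall U : set G, nbhs 0 U ->
    exists2 s : R, 0 < s & forall t : R, s < t -> A `<=` [set t *: u | u in U].

(* Main.v *)
(** Dilating [f] to [x |-> f (s *: x)] with [s > 1] preserves positive
    definiteness and moves the supports from the closures of [Omegap] and
    [Omegam] into their interiors. So each of the seven classes is sandwiched
    between the smallest one, on the interiors with closed supports, and the
    largest one, on the closures, and dilation maps the largest into the
    smallest. As bounded sets are relatively compact here, dominated convergence
    gives the integral of [f] as the limit of the integrals of its dilates as [s]
    decreases to [1], without computing the modulus of the dilations. *)
Require Import Defs.
From HB Require Import structures.
From mathcomp Require Import all_boot all_order all_algebra.
From mathcomp Require Import all_classical all_reals all_analysis.
From mathcomp Require Import measurable_realfun.
Import Order.TTheory GRing.Theory Num.Theory.
Import numFieldNormedType.Exports.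
Local Open Scope classical_set_scope.
Local Open Scope ring_scope.

Set Implicit Arguments.
Unset Strict Implicit.
Unset Printing Implicit Defensive.

(** * Scaling, Borel measurability and relative compactness *)

Lemma scaler_continuous (R : numDomainType) (G : topologicalLmodType R) (a : R) :
  continuous (fun x : G => a *: x).
Proof.
move=> x; apply: (@continuous_comp _ _ _ (fun y : G => (a : R^o, y))
  (fun z : R^o * G => z.1 *: z.2)); last exact: scale_continuous.
by apply: (@cvg_pair _ _ _ (nbhs _) (nbhs _) (nbhs _));
  [exact: cvg_cst|exact: cvg_id].
Qed.

Lemma scalel_continuous (R : numDomainType) (G : topologicalLmodType R) (x : G) :
  continuous (fun a : R^o => a *: x).
Proof.
move=> a; apply: (@continuous_comp _ _ _ (fun b : R^o => (b, x))
  (fun z : R^o * G => z.1 *: z.2)); last exact: scale_continuous.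
by apply: (@cvg_pair _ _ _ (nbhs _) (nbhs _) (nbhs _));
  [exact: cvg_id|exact: cvg_cst].
Qed.

(** Scaling is additive, so the sum for the dilate at the points [g i] is the sum for [f] at the
    points [a *: g i]. *)
Lemma positive_definite_scale (R : realType) (K : pzRingType) (G : lmodType K)
    (f : G -> R) (a : K) :
  positive_definite f -> positive_definite (fun x => f (a *: x)).
Proof.
move=> fpd n c g; have := fpd n c (fun i => a *: g i).
by under eq_bigr do under eq_bigr do rewrite -scalerBr.
Qed.

Lemma borel_open (G : topologicalZmodType) (U : set G) :
  open U -> measurable (U : set (borel G)).
Proof. by move=> oU; exact: sub_sigma_algebra. Qed.

Lemma borel_closed (G : topologicalZmodType) (A : set G) :
  closed A -> measurable (A : set (borel G)).
Proof.
by move=> /closed_openC/borel_open/measurableC; rewrite setCK.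
Qed.

Lemma continuous_borel_measurable (R : realType) (G : topologicalZmodType)
    (f : G -> R) :
  continuous f -> measurable_fun [set: borel G] f.
Proof.
move=> /continuousP cf; apply: (measurability _ (RGenOpens.measurableE R)).
move=> _ [_ [a [b ->] <-]]; rewrite setTI.
by apply: borel_open; exact/cf/interval_open.
Qed.

Lemma scale_compact (R : numDomainType) (G : topologicalLmodType R) (a : R)
    (K : set G) :
  compact K -> compact [set a *: x | x in K].
Proof.
by apply: continuous_compact; exact/continuous_subspaceT/scaler_continuous.
Qed.

(** A compact neighbourhood of 0 absorbs [A], so [A] lies in a compact dilate of it, which is closed
    because [G] is Hausdorff. *)
Lemma tvs_bounded_compact (R : realType) (G : topologicalLmodType R)
    (A : set G) :
  hausdorff_space G -> locally_compact [set: G] -> tvs_bounded A ->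
  compact (closure A).
Proof.
move=> hG lG bA; have [V nV [cV _]] := lG 0 I.
(* Local compactness gives [V] as a neighbourhood within [[set: G]]; this is a plain neighbourhood
   of 0. *)
have {}nV : nbhs 0 V.
  apply: (@filterS _ (nbhs (0 : G)) _ (fun x => [set: G] x -> V x)).
    by move=> x; apply.
  exact: nV.
have [s s0 /(_ (s + 1)) sA] := bA V nV.
have csV : compact [set (s + 1) *: x | x in V] by exact: scale_compact.
rewrite -precompactE; exists [set (s + 1) *: x | x in V].
  by apply: sA; rewrite ltrDl.
by split; [|exact: compact_closed].
Qed.

(** * Integrals and supports of functions and their dilates *)

Lemma integral_support (d : measure_display) (T : measurableType d)
    (R : realType) (mu : {measure set T -> \bar R}) (D : set T) (f : T -> R) :
  (forall x, f x != 0 -> D x) ->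
  (\int[mu]_x (f x)%:E = \int[mu]_(x in D) (f x)%:E)%E.
Proof.
move=> fD; rewrite [RHS]integral_mkcond; apply: eq_integral => x _.
rewrite patchE; case: ifPn => // /negP xD; congr EFin; apply/eqP.
by apply: contra_notT xD => fx; rewrite inE; exact: fD.
Qed.

Lemma continuous_support_bounded (R : realType) (T : topologicalType)
    (f : T -> R) (C : set T) :
  continuous f -> compact C -> (forall x, f x != 0 -> C x) ->
  exists2 M, 0 <= M & forall x, `|f x| <= M.
Proof.
move=> cf cC fC.
have /compact_bounded[M0 [_ /(_ (`|M0| + 1))M0P]] : compact (f @` C).
  by apply: continuous_compact => //; exact: continuous_subspaceT.
(* Boundedness of the image gives a bound for each number strictly above [M0]; this one is also
   nonnegative, which covers the points where [f] vanishes. *)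
exists (`|M0| + 1); first by rewrite addr_ge0.
move=> x; have [->|fx] := eqVneq (f x) 0; first by rewrite normr0 addr_ge0.
apply: M0P; first by rewrite ltr_pwDr// ler_norm.
by exists x => //; exact: fC.
Qed.

Section compact_support.
Context (R : realType) (G : topologicalLmodType R).
Context (mu : {measure set (borel G) -> \bar R}).
Hypotheses (hausdorffG : hausdorff_space G) (haar : is_haar mu).
Variable C : set G.
Hypothesis cptC : compact C.

Lemma borel_compact : measurable (C : set (borel G)).
Proof. by apply: borel_closed; exact: compact_closed. Qed.

Lemma integrable_cst_compact (M : R) :
  mu.-integrable (C : set (borel G)) (EFin \o cst M).
Proof.
apply: measurable_bounded_integrable; first exact: borel_compact.
- exact: (haar_compact haar).
- exact: measurable_cst.
- by exists `|M|; split; [exact: normr_real|move=> x Mx y _; exact: ltW].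
Qed.

(** The dominating function is a constant on [C] extended by 0, integrable because a Haar measure is
    finite on compact sets. *)
Lemma L1_compact_support (f : G -> R) :
  continuous f -> (forall x, f x != 0 -> C x) -> L1 mu f.
Proof.
move=> cf fC; have [M M0 fM] := continuous_support_bounded cf cptC fC.
have mf : measurable_fun [set: borel G] f by exact: continuous_borel_measurable.
have iM := (integrable_mkcond _ borel_compact).1 (integrable_cst_compact M).
apply: le_integrable iM => //; first exact/measurable_EFinP.
move=> x _; rewrite patchE /=; case: ifPn => [_|/negP xC].
  by rewrite lee_fin (ger0_norm M0).
rewrite abse0 lee_fin normr_le0; apply: contra_notT xC => fx.
by rewrite inE; exact: fC.
Qed.

(** A single compact set [C] carries [f] and all its dilates, so one constant on [C] dominates the
    whole sequence. *)
Lemma dilation_cvg (f : G -> R) (s : R^nat) :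
  continuous f -> (forall x, f x != 0 -> C x) ->
  (forall n x, f (s n *: x) != 0 -> C x) -> s @ \oo --> (1 : R) ->
  (\int[mu]_x (f (s n *: x))%:E)%E @[n --> \oo] --> (\int[mu]_x (f x)%:E)%E.
Proof.
move=> cf fC fsC s1; have [M M0 fM] := continuous_support_bounded cf cptC fC.
rewrite (integral_support mu fC).
under eq_fun do rewrite (integral_support mu (fsC _)).
apply: (@dominated_cvg _ _ _ mu C borel_compact _ _ (EFin \o cst M)) => //.
- move=> n; apply/measurable_EFinP.
  apply: (measurable_funS measurableT) => //.
  apply: continuous_borel_measurable => x.
  by apply: continuous_comp; [exact: scaler_continuous|exact: cf].
- move=> x _; apply: cvg_EFin; first by near=> n.
  (* Pointwise convergence: [s n *: x] tends to [1 *: x], and [f] is continuous at [x]. *)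
  have := @cvg_comp _ _ _ s (fun a : R^o => a *: (x : G)) _ _ _ s1
    (@scalel_continuous R G x 1).
  rewrite scale1r => sx.
  exact: (@cvg_comp _ _ _ _ f _ _ _ sx (cf x)).
- exact: integrable_cst_compact.
- by move=> n x _; rewrite lee_fin.
Unshelve. all: by end_near. Qed.

End compact_support.

(** The points that [s] sends into [closure A] form a closed set, which therefore contains all of
    [supp f]; the star condition with ratio [s^-1] then puts them in the interior. *)
Lemma supp_dilation (R : realType) (G : topologicalLmodType R) (f : G -> R)
    (s : R) (A : set G) :
  1 < s ->
  (forall r : R, 0 <= r < 1 -> [set r *: x | x in closure A] `<=` A°) ->
  (forall x, f x != 0 -> closure A (s *: x)) -> supp f `<=` A°.
Proof.
move=> s1 starA fA x fx; have s0 : 0 < s by exact: lt_trans s1.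
apply: (starA s^-1); first by rewrite invr_ge0 ltW//= invf_lt1.
exists (s *: x); last by rewrite scalerA mulVf ?scale1r// gt_eqF.
have cl : closed [set y : G | closure A (s *: y)].
  by apply: preimage_closed; [move=> y _; exact: scaler_continuous|
                              exact: closed_closure].
by apply: cl; exact: (closureS fA).
Qed.

(** * Comparison of the classes and of their suprema *)

Lemma delsarte_class_support (R : realType) (G : topologicalZmodType)
    (mu : {measure set (borel G) -> \bar R}) (A B : set G) (f : G -> R) (x : G) :
  delsarte_class mu A B f -> f x != 0 -> (A `|` B) x.
Proof.
move=> [_ _ fA fB]; rewrite neq_lt => /orP[fx|fx].
- by right; apply: fB; rewrite /= in_itv.
- by left; apply: fA; rewrite /= in_itv/= andbT.
Qed.

Lemma funrpos_neq0 (T : Type) (R : realDomainType) (f : T -> R) (x : T) :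
  (f^\+ x != 0) = (0 < f x).
Proof.
by rewrite /funrpos; case: leP => [fx|/[dup] fx /gt_eqF->]; rewrite ?eqxx.
Qed.

Lemma funrneg_neq0 (T : Type) (R : realDomainType) (f : T -> R) (x : T) :
  (f^\- x != 0) = (f x < 0).
Proof. by rewrite -funrposN funrpos_neq0 oppr_gt0. Qed.

Lemma delsarte_class_supp_sub (R : realType) (G : topologicalZmodType)
    (mu : {measure set (borel G) -> \bar R}) (A B : set G) :
  delsarte_class_supp mu A B `<=` delsarte_class mu A B.
Proof.
move=> f [Pf Lf fA fB]; split=> // x /=; rewrite in_itv/= ?andbT => fx.
- by apply: fA; apply: subset_closure; rewrite /= funrpos_neq0.
- by apply: fB; apply: subset_closure; rewrite /= funrneg_neq0.
Qed.

Lemma delsarte_class_mono (R : realType) (G : topologicalZmodType)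
    (mu : {measure set (borel G) -> \bar R}) (A A' B B' : set G) :
  A `<=` A' -> B `<=` B' -> delsarte_class mu A B `<=` delsarte_class mu A' B'.
Proof.
by move=> AA' BB' f [Pf Lf fA fB]; split=> // x; [move/fA/AA'|move/fB/BB'].
Qed.

Lemma delsarte_class_supp_mono (R : realType) (G : topologicalZmodType)
    (mu : {measure set (borel G) -> \bar R}) (A A' B B' : set G) :
  A `<=` A' -> B `<=` B' ->
  delsarte_class_supp mu A B `<=` delsarte_class_supp mu A' B'.
Proof.
by move=> AA' BB' f [Pf Lf fA fB]; split=> // x; [move/fA/AA'|move/fB/BB'].
Qed.

Lemma sup_integral_eq (R : realType) (G : topologicalZmodType)
    (mu : {measure set (borel G) -> \bar R}) (F0 F : set (G -> R)) :
  F0 `<=` F ->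
  (forall f, F f -> exists2 g : (G -> R)^nat, (forall n, F0 (g n)) &
     (\int[mu]_x (g n x)%:E)%E @[n --> \oo] --> (\int[mu]_x (f x)%:E)%E) ->
  sup_integral mu F = sup_integral mu F0.
Proof.
move=> F0F approx; rewrite /sup_integral.
(* The two classes are empty together, so the value 0 assigned to an empty class is taken on both
   sides or on neither. *)
have -> : (F !=set0) = (F0 !=set0).
  apply/propext; split=> [[f /approx[g F0g _]]|[f /F0F Ff]]; last by exists f.
  by exists (g 0%N).
case: ifP => // _; apply/eqP; rewrite eq_le; apply/andP; split; last first.
  by apply: ereal_sup_le; exact: image_subset.
apply: ge_ereal_sup => _ [f /approx[g F0g gf] <-].
(* The integral of [f] is a limit of integrals over [F0], each at most the supremum. *)
move/cvg_lim : (gf) => <-//; apply: lime_le.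
  by apply/cvg_ex; eexists; exact: gf.
by apply: nearW => n; apply: ereal_sup_ubound; exists (g n).
Qed.

(** * Dilation from the largest class into the smallest *)

Section dilation.
Context (R : realType) (G : topologicalLmodType R).
Context (mu : {measure set (borel G) -> \bar R}).
Hypotheses (hausdorffG : hausdorff_space G) (haar : is_haar mu).
Variables A B : set G.
Hypotheses (cptA : compact (closure A)) (cptB : compact (closure B)).
Hypothesis starA : forall r : R, 0 <= r < 1 ->
  [set r *: x | x in closure A] `<=` A°.
Hypothesis starB : forall r : R, 0 <= r < 1 ->
  [set r *: x | x in closure B] `<=` B°.

Let C := closure A `|` closure B.

Let cptC : compact C. Proof. exact: compactU. Qed.

(** The star conditions make [C] stable under [s^-1]. The bound [C] does not depend on [s], as
    dominated convergence requires. *)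
Lemma dilation_support (f : G -> R) (s : R) (x : G) :
  delsarte_class mu (closure A) (closure B) f -> 1 < s ->
  f (s *: x) != 0 -> C x.
Proof.
move=> Ff s1 /(delsarte_class_support Ff) sx.
have s0 : 0 < s by exact: lt_trans s1.
have s01 : 0 <= s^-1 < 1 by rewrite invr_ge0 ltW//= invf_lt1.
have xE : x = s^-1 *: (s *: x) by rewrite scalerA mulVf ?scale1r// gt_eqF.
case: sx => sx; [left; have Cx := starA s01|right; have Cx := starB s01].
- by apply: subset_closure; apply: interior_subset; apply: Cx; exists (s *: x).
- by apply: subset_closure; apply: interior_subset; apply: Cx; exists (s *: x).
Qed.

Lemma delsarte_class_dilation (f : G -> R) (s : R) :
  delsarte_class mu (closure A) (closure B) f -> 1 < s ->
  delsarte_class_supp mu A° B° (fun x => f (s *: x)).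
Proof.
move=> Ff s1; have [[cf fpd f0] _ fA fB] := Ff.
have cfs : continuous (fun x => f (s *: x)).
  by move=> x; apply: continuous_comp; [exact: scaler_continuous|exact: cf].
split.
- by split=> //=; [exact: positive_definite_scale|rewrite scaler0].
(* Integrability of the dilate comes from its continuity and compact support, with no change of
   variables. *)
- by apply: (L1_compact_support hausdorffG haar cptC) => // x;
    exact: dilation_support.
- apply: (supp_dilation s1 starA) => x; rewrite funrpos_neq0 => fx; apply: fA.
  by rewrite /= in_itv/= andbT.
- apply: (supp_dilation s1 starB) => x; rewrite funrneg_neq0 => fx; apply: fB.
  by rewrite /= in_itv.
Qed.

Lemma sup_integral_sandwich (F : set (G -> R)) :
  delsarte_class_supp mu A° B° `<=` F ->
  F `<=` delsarte_class mu (closure A) (closure B) ->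
  sup_integral mu F = delsarte_const_supp mu A° B°.
Proof.
move=> F0F FF1; apply: sup_integral_eq => // f /FF1 Ff.
(* The ratios [1 + 1/(n+1)] decrease to 1 and stay strictly above it, so each dilate lies in the
   smallest class. *)
pose s n : R := 1 + harmonic n.
have s1 n : 1 < s n by rewrite ltrDl harmonic_gt0.
exists (fun n x => f (s n *: x)) => [n|]; first exact: delsarte_class_dilation.
have [[cf _ _] _ _ _] := Ff.
apply: (dilation_cvg hausdorffG haar cptC) => //.
- by move=> x; exact: (delsarte_class_support Ff).
- by move=> n x; exact: (dilation_support Ff).
- rewrite -[X in _ --> X]addr0; apply: cvgD; first exact: cvg_cst.
  exact: cvg_harmonic.
Qed.

End dilation.

Theorem corollary34 (R : realType) (G : topologicalLmodType R)
    (hausdorffG : hausdorff_space G) (lcG : locally_compact [set: G])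
    (lambda : {measure set (borel G) -> \bar R}) (haar : is_haar lambda)
    (Omegap Omegam : set G)
    (bndp : tvs_bounded Omegap) (bndm : tvs_bounded Omegam)
    (symp : zero_symmetric Omegap) (symm : zero_symmetric Omegam)
    (starp : forall r : R, 0 <= r < 1 ->
       [set r *: x | x in closure Omegap] `<=` Omegap°)
    (starm : forall r : R, 0 <= r < 1 ->
       [set r *: x | x in closure Omegam] `<=` Omegam°) :
  delsarte_const_supp lambda Omegap° Omegam° = delsarte_const_supp lambda Omegap Omegam /\
  delsarte_const_supp lambda Omegap Omegam = delsarte_const lambda Omegap Omegam /\
  delsarte_const lambda Omegap Omegam = delsarte_const lambda Omegap° Omegam° /\
  delsarte_const lambda Omegap° Omegam° =
    delsarte_const lambda (closure Omegap°) (closure Omegam°) /\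
  delsarte_const lambda (closure Omegap°) (closure Omegam°) =
    delsarte_const_supp lambda (closure Omegap°) (closure Omegam°) /\
  delsarte_const_supp lambda (closure Omegap°) (closure Omegam°) =
    delsarte_const_supp lambda (closure Omegap) (closure Omegam).
Proof.
have cptp := tvs_bounded_compact hausdorffG lcG bndp.
have cptm := tvs_bounded_compact hausdorffG lcG bndm.
have sandwich := sup_integral_sandwich hausdorffG haar cptp cptm starp starm.
have bounds (P Q : set G) : Omegap° `<=` P -> P `<=` closure Omegap ->
    Omegam° `<=` Q -> Q `<=` closure Omegam ->
    delsarte_const lambda P Q = delsarte_const_supp lambda Omegap° Omegam° /\
    delsarte_const_supp lambda P Q = delsarte_const_supp lambda Omegap° Omegam°.
  (* The support class on [P], [Q] lies in the sign class on [P], [Q]; the former contains the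
     smallest class and the latter lies in the largest, so both are sandwiched. *)
  move=> pP Pp mQ Qm; have supp_sub := @delsarte_class_supp_sub _ _ lambda P Q.
  have sub_mono := delsarte_class_mono (mu := lambda) Pp Qm.
  have mono_supp := delsarte_class_supp_mono (mu := lambda) pP mQ.
  by split; apply: sandwich => //;
    [exact: subset_trans supp_sub|exact: subset_trans sub_mono].
have iC (A : set G) : A° `<=` closure A.
  exact: subset_trans (@interior_subset _ A) (@subset_closure _ A).
(* The pair [P], [Q] is taken in turn to be the given sets, their interiors, the closures of their
   interiors, and their closures; every constant becomes the one of the smallest class. *)
have [-> ->] := bounds _ _ (@interior_subset _ _) (@subset_closure _ _)
  (@interior_subset _ _) (@subset_closure _ _).
have [-> _] := bounds _ _ (@subset_refl _ _) (iC _) (@subset_refl _ _) (iC _).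
have [-> ->] := bounds _ _ (@subset_closure _ _) (closureS (@interior_subset _ _))
  (@subset_closure _ _) (closureS (@interior_subset _ _)).
by have [_ ->] := bounds _ _ (iC _) (@subset_refl _ _) (iC _) (@subset_refl _ _).
Qed.
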